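(* Consider a one-to-one two-sided matching market that has an individually rational matching of size $n$ (i.e. containing $n$ worker–firm pairs). Then every stable matching of the market has at least $\lceil \frac{n}{2}\rceil$ pairs.
   Context: A one-to-one two-sided matching market consists of a finite set $W$ of workers and a finite set $F$ of (single-position) firms, disjoint from $W$. The two sides need not have the same size. Each participant has a complete, transitive and strict preference ordering over some nonempty subset of the participants on the other side (those it prefers to being unmatched); it prefers being unmatched to any participant outside this subset. A pair $(w,f)\in W\times F$ is acceptable if $w$ and $f$ each prefer the other to being unmatched. It is assumed that every participant belongs to at least one acceptable pair. Equivalently, the market is a bipartite graph $(W,F;E)$ whose edge set $E$ is the set of acceptable pairs, where each vertex has a strict preference ranking over its neighbours. A matching is a one-to-one map $\mu$ from $W\cup F$ to itself such that $\mu(w)=f$ if and only if $\mu(f)=w$ for $w\in W$, $f\in F$; if $\mu(w)\notin F$ then $\mu(w)=w$ ($w$ is unmatched); and if $\mu(f)\notin W$ then $\mu(f)=f$ ($f$ is unmatched). A matching is identified with its set of pairs $(w,f)$ with $\mu(w)=f$, and its size is the number of these pairs. A matching is individually rational if no participant prefers being unmatched to its partner, i.e. all its pairs are acceptable. A matching $\mu$ is stable if it is individually rational and there is no blocking pair, i.e. no acceptable pair $(w,f)$ such that $w$ is unmatched or prefers $f$ to $\mu(w)$, and $f$ is unmatched or prefers $w$ to $\mu(f)$. *)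

(* Defs.v *)
From mathcomp Require Import all_boot.

Set Implicit Arguments.
Unset Strict Implicit.
Unset Printing Implicit Defensive.

(* [r x y] reads "x is preferred to y"; nothing is asked of [r] outside [A]. *)
Definition strict_preference (T : finType) (A : {set T}) (r : rel T) : Prop :=
  [/\ {in A, irreflexive r},
      {in A & &, transitive r} &
      {in A &, forall x y, x != y -> r x y || r y x}].

(* The participants preferred to being unmatched are those in [optW w] (for a
   worker) and [optF f] (for a firm); being unmatched is preferred to all
   others.  The order on these is [prefW w], resp. [prefF f]. *)
Record market (W F : finType) := Market {
  optW : W -> {set F};
  optF : F -> {set W};
  prefW : W -> rel F;
  prefF : F -> rel W;
  optW_neq0 : forall w, optW w != set0;
  optF_neq0 : forall f, optF f != set0;
  prefW_strict : forall w, strict_preference (optW w) (prefW w);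
  prefF_strict : forall f, strict_preference (optF f) (prefF f);
  acceptableW : forall w, exists f, (f \in optW w) && (w \in optF f);
  acceptableF : forall f, exists w, (f \in optW w) && (w \in optF f)
}.

Definition acceptable (W F : finType) (M : market W F) (w : W) (f : F) : bool :=
  (f \in optW M w) && (w \in optF M f).

Record matching (W F : finType) := Matching {
  partner :> W + F -> W + F;
  partner_inj : injective partner;
  partner_sym : forall w f, partner (inl w) = inr f <-> partner (inr f) = inl w;
  partnerW_self :
    forall w, (forall f, partner (inl w) <> inr f) -> partner (inl w) = inl w;
  partnerF_self :
    forall f, (forall w, partner (inr f) <> inl w) -> partner (inr f) = inr f
}.

Definition matched_pairs (W F : finType) (mu : matching W F) : {set W * F} :=
  [set p | mu (inl p.1) == inr p.2].

Definition matching_size (W F : finType) (mu : matching W F) : nat :=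
  #|matched_pairs mu|.

Definition individually_rational (W F : finType) (M : market W F)
    (mu : matching W F) : Prop :=
  forall w f, (w, f) \in matched_pairs mu -> acceptable M w f.

Definition blocking_pair (W F : finType) (M : market W F)
    (mu : matching W F) (w : W) (f : F) : Prop :=
  [/\ acceptable M w f,
      mu (inl w) = inl w \/
        (exists2 f', mu (inl w) = inr f' & prefW M w f f') &
      mu (inr f) = inr f \/
        (exists2 w', mu (inr f) = inl w' & prefF M f w w')].

Definition stable (W F : finType) (M : market W F) (mu : matching W F) : Prop :=
  individually_rational M mu /\ (forall w f, ~ blocking_pair M mu w f).

(* Main.v *)
(* By stability every acceptable pair has an endpoint matched by [nu]; so each
   pair of [mu] is determined either by its worker, among the workers matched
   by [nu], or by its firm, among the firms matched by [nu], and there are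
   [matching_size nu] of each. *)
Require Import Defs.
From mathcomp Require Import all_boot.

Lemma matched_pairs_fst_inj (W F : finType) (mu : matching W F) :
  {in matched_pairs mu &, injective fst}.
Proof.
move=> [w f] [w' f']; rewrite !inE /= => /eqP wf /eqP + ww'.
by rewrite -ww' wf => -[->].
Qed.

(** Two workers sharing a firm have the same image under [mu], so [partner_inj] identifies them. *)
Lemma matched_pairs_snd_inj (W F : finType) (mu : matching W F) :
  {in matched_pairs mu &, injective snd}.
Proof.
move=> [w f] [w' f']; rewrite !inE /= => /eqP wf /eqP wf' ff'.
by rewrite -ff' -wf in wf' *; case: (partner_inj wf') => ->.
Qed.

(** Otherwise [w] and [f] are both their own partners under [nu], hence block it. *)
Lemma stable_acceptable_matched (W F : finType) (M : market W F)
    (nu : matching W F) (w : W) (f : F) :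
  stable M nu -> acceptable M w f ->
  (w \in fst @: matched_pairs nu) || (f \in snd @: matched_pairs nu).
Proof.
move=> [_ noblock] wf_acc; apply/norP => -[w_free f_free].
apply: (noblock w f); split=> //; left.
  apply: partnerW_self => f' wf'; case/imsetP: w_free.
  by exists (w, f'); rewrite // inE /= wf'.
apply: partnerF_self => w' /partner_sym w'f; case/imsetP: f_free.
by exists (w', f); rewrite // inE /= w'f.
Qed.

(** [h] embeds the left-hand set into [h @: B], which is no larger than [B]. *)
Lemma card_preim_imset_le (T U : finType) (h : T -> U) (A B : {set T}) :
  {in A &, injective h} -> #|A :&: h @^-1: (h @: B)| <= #|B|.
Proof.
move=> h_inj; rewrite -(card_in_imset (f := h)).
  apply: leq_trans (leq_imset_card h B); apply: subset_leq_card.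
  by apply/subsetP => _ /imsetP[p + ->]; rewrite !inE => /andP[].
by move=> p q /setIP[pA _] /setIP[qA _]; apply: h_inj.
Qed.

Theorem theorem1 (W F : finType) (M : market W F) (n : nat)
    (Hn : exists mu : matching W F,
        individually_rational M mu /\ matching_size mu = n)
    (nu : matching W F) (Hnu : stable M nu) :
  uphalf n <= matching_size nu.
Proof.
have [mu [mu_ir <-]] := Hn.
(* The ceiling bound becomes a sum of two copies of the size of [nu]: one for workers, one for
   firms. *)
rewrite leq_uphalf_double -addnn.
set A := matched_pairs mu; set B := matched_pairs nu.
pose A1 := A :&: fst @^-1: (fst @: B); pose A2 := A :&: snd @^-1: (snd @: B).
have sAA12 : A \subset A1 :|: A2.
  apply/subsetP => -[w f] wfA.
  have := stable_acceptable_matched _ _ _ _ _ _ Hnu (mu_ir _ _ wfA).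
  by rewrite in_setU !in_setI wfA ![_ \in _ @^-1: _]inE.
apply: leq_trans (subset_leq_card sAA12) _.
(* [A1] and [A2] may overlap; the union bound suffices. *)
apply: leq_trans (leq_card_setU A1 A2) _; apply: leq_add.
- by apply: card_preim_imset_le; apply: matched_pairs_fst_inj.
- by apply: card_preim_imset_le; apply: matched_pairs_snd_inj.
Qed.
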